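(* Let $n, m \ge 1$ be integers and let $A\in \mathbb{R}^{n\times n}$ and $B\in \mathbb{R}^{n\times m}$ be matrices such that the pair $(A,B)$ is controllable. Set $L = (n-1)(n+2)/2$. Then there exists a constant $M>0$, depending only on $A$, $B$ and $n$ (in particular, independent of $\lambda$), such that for every real $\lambda \ge 1$ there exists a matrix $K\in \mathbb{R}^{m\times n}$ with $$\left\|e^{(A+BK)t}\right\|\leq M\lambda^L e^{-\lambda t}\quad \text{for all } t\geq 0.$$
   Context: $\|\cdot\|$ denotes the operator norm on $\mathbb{R}^{n\times n}$ induced by the Euclidean norm on $\mathbb{R}^n$. The pair $(A,B)$ is controllable if the linear system $\dot x = Ax+Bu$ is controllable, equivalently if the $n\times nm$ matrix $(B, AB, \ldots, A^{n-1}B)$ has rank $n$. *)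

(* Defs.v *)
From HB Require Import structures.
From mathcomp Require Import all_boot all_order all_algebra.
From mathcomp Require Import all_classical all_reals all_analysis.

Set Implicit Arguments.
Unset Strict Implicit.
Unset Printing Implicit Defensive.

Import Order.TTheory GRing.Theory Num.Theory.
Import numFieldNormedType.Exports.

Local Open Scope classical_set_scope.
Local Open Scope ring_scope.

(* The library norm on matrices is the max norm, whence these two. *)
Definition enorm (R : realType) (n : nat) (x : 'cV[R]_n) : R :=
  Num.sqrt (\sum_(i < n) x i 0 ^+ 2).

Definition opnorm (R : realType) (m n : nat) (A : 'M[R]_(m, n)) : R :=
  sup [set enorm (A *m x) | x in [set x : 'cV[R]_n | enorm x <= 1]].

(* The limit is taken in the (entrywise) topology of 'M[R]_n; the series
   converges for every A (is_cvg_series_expmx_coeff below). *)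
Definition expmx_coeff (R : realType) (n : nat) (A : 'M[R]_n) : nat -> 'M[R]_n :=
  fun k => k`!%:R^-1 *: A ^+ k.

Definition expmx (R : realType) (n : nat) (A : 'M[R]_n) : 'M[R]_n :=
  limn (series (expmx_coeff A)).

Definition kalman_mx (R : realType) (n m : nat) (A : 'M[R]_n)
    (B : 'M[R]_(n, m)) : 'M[R]_(n, \sum_(k < n) m) :=
  \mxrow_(k < n) (A ^+ k *m B).

Definition controllable (R : realType) (n m : nat) (A : 'M[R]_n)
    (B : 'M[R]_(n, m)) : Prop :=
  \rank (kalman_mx A B) = n.

(* The supremum defining opnorm is over a nonempty bounded set. *)
Lemma has_sup_opnorm (R : realType) (m n : nat) (A : 'M[R]_(m, n)) :
  has_sup [set enorm (A *m x) | x in [set x : 'cV[R]_n | enorm x <= 1]].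
Proof.
split.
  exists (enorm (A *m 0)), 0 => //=; rewrite /enorm big1 ?sqrtr0// => i _.
  by rewrite mxE expr0n.
exists (Num.sqrt (\sum_(i < m) (\sum_(j < n) `|A i j|) ^+ 2)) => _ [x /= x1 <-].
rewrite /enorm ler_wsqrtr// ler_sum// => i _; rewrite mxE -[leLHS]real_normK ?num_real//.
rewrite lerXn2r// ?nnegrE ?sumr_ge0// (le_trans (ler_norm_sum _ _ _))//.
rewrite ler_sum// => j _; rewrite normrM ler_piMr//.
apply: le_trans x1; rewrite /enorm -sqrtr_sqr ler_wsqrtr//.
by rewrite (bigD1 j)//= lerDl sumr_ge0// => k _; rewrite sqr_ge0.
Qed.

Lemma mx_norm_mulmx (R : realType) (n : nat) (A B : 'M[R]_n) :
  `|A *m B| <= n%:R * `|A| * `|B|.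
Proof.
have entry (C : 'M[R]_n) i j : `|C i j| <= `|C|.
  by rewrite [leRHS]mx_normrE (le_bigmax _ (fun ij => `|C ij.1 ij.2|) (i, j)).
rewrite [leLHS]mx_normrE; apply: bigmax_le => [|[i j] _ /=].
  by rewrite !mulr_ge0.
rewrite mxE (le_trans (ler_norm_sum _ _ _))//.
rewrite (@le_trans _ _ (\sum_(k < n) (`|A| * `|B|)))//.
  by apply: ler_sum => k _; rewrite normrM ler_pM.
by rewrite sumr_const card_ord -mulrA mulr_natl.
Qed.

Lemma is_cvg_series_expmx_coeff (R : realType) (n : nat) (A : 'M[R]_n) :
  cvgn (series (expmx_coeff A)).
Proof.
suff /cauchy_cvgP/cauchy_seriesP ncvg : cvgn [normed series (expmx_coeff A)].
  apply/cauchy_cvgP/cauchy_seriesP => e /ncvg.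
  apply: filterS => k /=; rewrite ger0_norm ?sumr_ge0//.
  by apply: le_lt_trans; exact: ler_norm_sum.
pose c : R := `|1%:M : 'M[R]_n|.
apply: (@series_le_cvg _ _ (c *: exp_coeff (n%:R * `|A|))).
- by move=> k; exact: normr_ge0.
- by move=> k; rewrite /= mulr_ge0 ?normr_ge0// exp_coeff_ge0 ?mulr_ge0.
- move=> k /=; rewrite /expmx_coeff normrZ ger0_norm ?invr_ge0//.
  rewrite [leRHS](_ : _ = k`!%:R^-1 * (c * (n%:R * `|A|) ^+ k)); last first.
    by rewrite [RHS]mulrC -[RHS]mulrA.
  rewrite ler_wpM2l ?invr_ge0//.
  elim: k => [|k IHk]; first by rewrite !expr0 mulr1.
  rewrite exprS (le_trans (mx_norm_mulmx _ _))// exprS mulrCA.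
  by rewrite ler_wpM2l// mulr_ge0.
- apply: is_cvg_seriesZ; exact: is_cvg_series_exp_coeff.
Qed.

(* Main.v *)
(* Transposing, controllability says that every A^T-invariant row space
   containing the rows of B^T is everything. Hence (Heymann) there is a chain
   x_0, x_1, ... with x_0 and x_(k+1) - x_k A^T in the row space of B^T, whose
   first n terms form a basis. Combining its terms linearly gives such a chain
   z with z_n = 0, and then y(mu) = \sum_k mu^(n-1-k) z_k is an eigenvector of
   A^T for mu modulo the row space of B^T, hence a genuine eigenvector after a
   suitable feedback. Prescribing the eigenvalues - lambda, ..., - n lambda,
   the eigenvector matrix is W = Q^T diag(lambda^j) V0 with Q and the
   Vandermonde matrix V0 independent of lambda, so its condition number is
   O(lambda^(n-1)), which is O(lambda^L) as n - 1 <= L. *)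

Require Import Defs.
From HB Require Import structures.
From mathcomp Require Import all_boot all_order all_algebra.
From mathcomp Require Import all_classical all_reals all_analysis.
From mathcomp Require Import ring.

Set Implicit Arguments.
Unset Strict Implicit.
Unset Printing Implicit Defensive.

Import Order.TTheory GRing.Theory Num.Theory.
Import numFieldNormedType.Exports.

Local Open Scope classical_set_scope.
Local Open Scope ring_scope.

(** * Chains and eigenvectors modulo a row space *)

(** Stability puts the rows of every [(A ^+ k *m B)^T] in [S], so the transposed cokernel of [S]
    kills the row-free [kalman_mx A B] and must vanish. *)
Lemma controllable_row_full (R : realType) (n m : nat) (A : 'M[R]_n)
    (B : 'M[R]_(n, m)) (S : 'M[R]_n) :
  controllable A B -> (B^T <= S)%MS -> stablemx S A^T -> row_full S.
Proof.
move=> hAB BS SA; rewrite -cokermx_eq0 -trmx_eq0.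
have Ak k : ((A ^+ k *m B)^T <= S)%MS.
  elim: k => [|k IHk]; first by rewrite expr0 mul1mx.
  rewrite exprS -mulmxE -mulmxA trmx_mul (submx_trans _ SA)//.
  exact: submxMr.
have /mulmx_free_eq0 <- : row_free (kalman_mx A B) by apply/eqP.
rewrite mul_mxrow; apply/eqP; rewrite -[RHS]mxrow0; apply: eq_mxrow => k.
apply: trmx_inj; rewrite trmx_mul trmxK trmx0; apply/eqP; rewrite -submxE.
exact: Ak.
Qed.

Lemma exists_spanning_chain (F : fieldType) (n m : nat) (A : 'M[F]_n)
    (B : 'M[F]_(m, n)) :
  (forall S : 'M[F]_n, (B <= S)%MS -> stablemx S A -> row_full S) ->
  exists x : nat -> 'rV[F]_n, [/\ (x 0%N <= B)%MS,
    forall k, (x k.+1 - x k *m A <= B)%MS & row_full (\sum_(i < n) <<x i>>)%MS].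
Proof.
move=> genAB.
suff /(_ n (leqnn n)) [x [x0 xS rkx]] : forall k, (k <= n)%N ->
    exists x : nat -> 'rV[F]_n, [/\ (x 0%N <= B)%MS,
      forall k, (x k.+1 - x k *m A <= B)%MS &
      (k <= \rank (\sum_(i < k) <<x i>>)%MS)%N].
  by exists x; split=> //; rewrite /row_full eqn_leq rank_leq_col.
elim=> [_|k IHk kn].
  by exists (fun=> 0); split=> // [|k]; rewrite ?mul0mx ?subr0 sub0mx.
have {IHk} [x [x0 xS rkx]] := IHk (ltnW kn).
set S : 'M[F]_n := (\sum_(i < k) <<x i>>)%MS in rkx.
have xiS i : (i < k)%N -> (x i <= S)%MS.
  by move=> ik; rewrite (sumsmx_sup (Ordinal ik))// genmxE.
have [Sfull|Snfull] := boolP (row_full S).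
  exists x; split=> //; rewrite big_ord_recr /= -/S (leq_trans kn)//.
  by rewrite (leq_trans (eq_leq (esym (eqP Sfull))))// mxrankS// addsmxSl.
(* The next term must be [p] plus a row of [B]'s span; for [k = 0] there is no predecessor, hence
   0. *)
pose p : 'rV[F]_n := if k is k'.+1 then x k' *m A else 0.
have pE i : i.+1 = k -> p = x i *m A by rewrite /p => <-.
(* Otherwise [s = 0] puts [p] in [S], differences put [B] in [S], and [S] is then [A]-stable, hence
   full. *)
have [s psS] : exists s : 'rV_m, ~~ ((p + s *m B)%R <= S)%MS.
  apply: contrapT => /forallNP all_psS; move/negP: Snfull; apply.
  have {}all_psS (s : 'rV_m) : ((p + s *m B)%R <= S)%MS.
    by have /negP/negPn := all_psS s.
  have pS : (p <= S)%MS by have := all_psS 0; rewrite mul0mx addr0.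
  have BS : (B <= S)%MS.
    apply/row_subP => i; rewrite rowE -[_ *m B](addKr p).
    by rewrite addmx_sub ?eqmx_opp.
  apply: genAB => //; rewrite sumsmxMr.
  apply/sumsmx_subP => i _; rewrite (eqmxMr _ (genmxE _)).
  have [ik|] := ltnP i.+1 k.
    rewrite -[_ *m A](subKr (x i.+1)) addmx_sub ?xiS// eqmx_opp.
    by rewrite (submx_trans (xS i)).
  by move=> ki; rewrite -pE//; apply/eqP; rewrite eqn_leq ltn_ord ki.
(* Past index [k] the chain just iterates [A], with zero defect. *)
pose y i := if (i < k)%N then x i else iter (i - k) (mulmxr A) (p + s *m B).
exists y; split.
- rewrite /y; case: ltnP => // k0.
  have -> : p = 0 by rewrite /p; case: (k) k0.
  by rewrite sub0n /= add0r submxMl.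
- move=> i; rewrite /y.
  have [ik|ki] := ltnP i.+1 k; first by rewrite (ltnW ik) xS.
  have [ik|{}ki] := ltnP i k.
    have eik : k = i.+1 by apply/eqP; rewrite eqn_leq ik ki.
    by rewrite (pE i)// eik subnn /= addrAC subrr add0r submxMl.
  by rewrite subSn//= subrr sub0mx.
- rewrite big_ord_recr /=.
  have -> : (\sum_(i < k) <<y i>>)%MS = S.
    by apply: eq_bigr => i _; rewrite /y ltn_ord.
  rewrite (leq_ltn_trans rkx)// rank_ltmx// /ltmx addsmxSl/=.
  apply: contra psS; rewrite addsmx_sub genmxE => /andP[_].
  by rewrite /y ltnn subnn.
Qed.

(* Convolving with the coefficients of the relation expressing [x n] through
   [x 0, ..., x (n - 1)] makes the chain terminate. *)
Lemma exists_terminating_chain (F : fieldType) (n m : nat) (A : 'M[F]_n)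
    (B : 'M[F]_(m, n)) (x : nat -> 'rV[F]_n) :
  (x 0%N <= B)%MS -> (forall k, (x k.+1 - x k *m A <= B)%MS) ->
  row_full (\sum_(i < n) <<x i>>)%MS ->
  exists z : nat -> 'rV[F]_n, [/\ (z 0%N <= B)%MS,
    forall k, (z k.+1 - z k *m A <= B)%MS, row_full (\sum_(i < n) <<z i>>)%MS &
    z n = 0].
Proof.
move=> x0 xS xfull.
have /sub_sums_genmxP[d xn] : (x n <= \sum_(i < n) <<x i>>)%MS.
  exact: submx_full.
(* Only [c 0 = 1] (spanning) and [c (n - i) = - d i] for [i < n] (termination) matter; the chain
   condition holds for any [c]. *)
pose c k :=
  if k is 0 then 1 else if insub (n - k)%N is Some i then - d i 0 0 else 0.
pose z k := \sum_(i < k.+1) c (k - i)%N *: x i.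
have zE k : z k = \sum_(i < k) c (k - i)%N *: x i + x k.
  by rewrite /z big_ord_recr /= subnn scale1r.
exists z; split.
- by rewrite zE big_ord0 add0r.
- move=> k; rewrite /z big_ord_recl /= mulmx_suml -addrA -sumrB.
  rewrite addmx_sub ?scalemx_sub// summx_sub// => i _.
  by rewrite -scalemxAl -scalerBr scalemx_sub// xS.
- rewrite -sub1mx (submx_trans _ (_ : \sum_(i < n) <<x i>> <= _)%MS) ?sub1mx//.
  apply/sumsmx_subP => -[i /= ni] _; rewrite genmxE.
  (* The change from [x] to [z] is unitriangular, so each [x i] is recovered from [z i] and earlier
     terms. *)
  elim/ltn_ind: i ni => i IHi ni.
  have -> : x i = z i - \sum_(j < i) c (i - j)%N *: x j.
    by rewrite zE addrC addKr.
  rewrite addmx_sub//; first by rewrite (sumsmx_sup (Ordinal ni))// genmxE.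
  rewrite eqmx_opp summx_sub// => j _; rewrite scalemx_sub// IHi//.
  exact: ltn_trans ni.
- rewrite zE xn -big_split/= big1// => i _.
  have ->: c (n - i)%N = - d i 0 0.
    rewrite /c; case E: (n - i)%N => [|k].
      by move/eqP: E; rewrite subn_eq0 leqNgt ltn_ord.
    by rewrite -E subKn ?(ltnW (ltn_ord i))// valK.
  by rewrite {2}[d i]mx11_scalar mul_scalar_mx scaleNr addNr.
Qed.

Lemma exists_eigenvector_basis (F : fieldType) (n m : nat) (A : 'M[F]_n)
    (B : 'M[F]_(m, n)) :
  (forall S : 'M[F]_n, (B <= S)%MS -> stablemx S A -> row_full S) ->
  exists2 Q : 'M[F]_n, Q \in unitmx & forall (mu : F) (y : 'rV[F]_n),
    y = (\row_(j < n) mu ^+ j) *m Q -> (y *m A - mu *: y <= B)%MS.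
Proof.
move=> /exists_spanning_chain[x [x0 xS]].
move=> /(exists_terminating_chain x0 xS)[z [z0 zS zfull zn]].
exists (\matrix_(j < n) z (rev_ord j)).
  rewrite -row_full_unit -sub1mx.
  rewrite (submx_trans _ (_ : \sum_(i < n) <<z i>> <= _)%MS) ?sub1mx//.
  apply/sumsmx_subP => i _; rewrite genmxE -[i]rev_ordK.
  by rewrite (eq_row_sub (rev_ord i))// rowK.
move=> mu y yE.
have -> : y = \sum_(k < n) mu ^+ (n - k.+1) *: z k.
  rewrite yE mulmx_sum_row [RHS](reindex_inj rev_ord_inj)/=.
  by apply: eq_bigr => k _; rewrite rowK mxE /= subnSK// subKn// ltnW.
have -> : (\sum_(k < n) mu ^+ (n - k.+1) *: z k) *m A -
    mu *: \sum_(k < n) mu ^+ (n - k.+1) *: z k =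
  (\sum_(k < n) mu ^+ (n - k.+1) *: (z k *m A - z k.+1)) - mu ^+ n *: z 0%N.
  (* Since [z n = 0], telescoping leaves only a multiple of [z 0], which lies in the row space of
     [B]. *)
  have : \sum_(0 <= k < n) (mu ^+ (n - k.+1) *: z k.+1 - mu ^+ (n - k) *: z k) =
      - (mu ^+ n *: z 0%N).
    by rewrite telescope_sumr// zn scaler0 sub0r subn0.
  rewrite big_mkord => <-; rewrite mulmx_suml scaler_sumr -big_split -sumrB /=.
  apply: eq_bigr => k _.
  by rewrite scalerBr addrA subrK scalemxAl scalerA -exprS subnSK.
rewrite addmx_sub ?eqmx_opp ?scalemx_sub// summx_sub// => k _.
by rewrite scalemx_sub// -eqmx_opp opprB.
Qed.

(** * Norm bounds and exponentials of diagonalizable matrices *)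

Lemma ler_mx_norm (R : realType) (m n : nat) (A : 'M[R]_(m, n)) (c : R) :
  0 <= c -> (forall i j, `|A i j| <= c) -> `|A| <= c.
Proof.
by move=> c0 Ac; rewrite [leLHS]mx_normrE; apply: bigmax_le => // -[i j] _.
Qed.

Lemma mx_entry_le_norm (R : realType) (m n : nat) (A : 'M[R]_(m, n)) i j :
  `|A i j| <= `|A|.
Proof.
by rewrite [leRHS]mx_normrE (le_bigmax _ (fun ij => `|A ij.1 ij.2|) (i, j)).
Qed.

Lemma opnorm_le_mx_norm (R : realType) (m n : nat) (A : 'M[R]_(m, n)) :
  opnorm A <= (m * n)%:R * `|A|.
Proof.
apply: ge_sup; first by have [] := has_sup_opnorm A.
move=> _ [x /= x1 <-].
have xj j : `|x j 0| <= 1.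
  apply: le_trans x1; rewrite /enorm -sqrtr_sqr ler_wsqrtr//.
  by rewrite (bigD1 j)//= lerDl sumr_ge0// => k _; rewrite sqr_ge0.
have Axi i : `|(A *m x) i 0| <= n%:R * `|A|.
  rewrite mxE (le_trans (ler_norm_sum _ _ _))//.
  rewrite (@le_trans _ _ (\sum_(j < n) `|A|))//.
    apply: ler_sum => j _; rewrite normrM -[leRHS]mulr1.
    by rewrite ler_pM// ?mx_entry_le_norm.
  by rewrite sumr_const card_ord mulr_natl.
have mnA0 : 0 <= (m * n)%:R * `|A| by rewrite mulr_ge0.
rewrite /enorm -(ger0_norm mnA0) -sqrtr_sqr ler_wsqrtr//.
rewrite (@le_trans _ _ (\sum_(i < m) (n%:R * `|A|) ^+ 2))//.
  apply: ler_sum => i _; rewrite -[leLHS]real_normK ?num_real//.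
  by rewrite lerXn2r// ?nnegrE ?mulr_ge0.
rewrite sumr_const card_ord -[leLHS]mulr_natl natrM -mulrA.
move: (n%:R * `|A|) => c; rewrite exprMn.
rewrite ler_wpM2r ?sqr_ge0// -natrX ler_nat.
by case: m {A mnA0 x1 xj Axi} => // m; rewrite leq_pmulr.
Qed.

(** Powers of [A] are diagonalized by [W], so each entry of a partial sum is a fixed finite
    combination of scalar exponential partial sums; limits are taken entrywise. *)
Lemma expmx_diagonalized (R : realType) (n : nat) (A W V : 'M[R]_n)
    (d : 'rV[R]_n) :
  W *m V = 1%:M -> A *m W = W *m diag_mx d ->
  expmx A = W *m diag_mx (map_mx expR d) *m V.
Proof.
move=> WV AW.
have AkW k : A ^+ k *m W = W *m diag_mx (\row_l d 0 l ^+ k).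
  elim: k => [|k IHk].
    rewrite expr0 mul1mx (_ : diag_mx _ = 1%:M) ?mulmx1//.
    by apply/matrixP => i j; rewrite !mxE expr0.
  rewrite exprS -mulmxE -mulmxA IHk mulmxA AW -mulmxA mulmx_diag.
  by congr (_ *m diag_mx _); apply/rowP => l; rewrite !mxE exprS.
have Ak k : A ^+ k = W *m diag_mx (\row_l d 0 l ^+ k) *m V.
  by rewrite -AkW -mulmxA WV mulmx1.
apply/matrixP => i j.
have cvA : (series (expmx_coeff A) N i j @[N --> \oo] --> expmx A i j).
  apply: (cvg_comp (series (expmx_coeff A)) (fun M : 'M[R]_n => M i j)).
    exact: is_cvg_series_expmx_coeff.
  exact: coord_continuous.
apply/esym/(cvg_unique _ _ cvA) => //.
have -> : (fun N => series (expmx_coeff A) N i j) =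
    (fun N => \sum_l W i l * series (exp_coeff (d 0 l)) N * V l j).
  apply/funext => N; rewrite /series /= summxE.
  under [RHS]eq_bigr do rewrite mulr_sumr mulr_suml.
  rewrite exchange_big; apply: eq_bigr => k _.
  rewrite /expmx_coeff Ak !mxE mulr_sumr; apply: eq_bigr => l _.
  by rewrite mul_mx_diag !mxE /exp_coeff /=; ring.
rewrite mxE; apply: cvg_big => [|l _]; first exact: add_continuous.
rewrite mul_mx_diag !mxE.
apply: cvgM; last exact: cvg_cst.
by apply: cvgM; [exact: cvg_cst|exact: is_cvg_series_exp_coeff].
Qed.

Lemma mx_norm_diag_mx (R : realType) (n : nat) (d : 'rV[R]_n) (c : R) :
  0 <= c -> (forall i, `|d 0 i| <= c) -> `|diag_mx d| <= c.
Proof.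
move=> c0 dc; apply: ler_mx_norm => // i j; rewrite mxE.
by case: eqP => _; rewrite ?mulr1n ?mulr0n ?normr0.
Qed.

Lemma Vandermonde_unitmx (F : fieldType) (n : nat) (a : 'rV[F]_n) :
  injective (a 0) -> Vandermonde n a \in unitmx.
Proof.
move=> a_inj; rewrite unitmxE det_Vandermonde unitfE.
apply/prodf_neq0 => i _; apply/prodf_neq0 => j ij.
by rewrite subr_eq0; apply: contraTN ij => /eqP/a_inj ->; rewrite ltnn.
Qed.

(** * Feedback and the decay estimate *)

Theorem proposition2p1 (R : realType) (n m : nat) (hn : (1 <= n)%N)
    (hm : (1 <= m)%N) (A : 'M[R]_n) (B : 'M[R]_(n, m))
    (hAB : controllable A B) :
  exists2 M : R, 0 < M &
    forall lambda : R, 1 <= lambda ->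
      exists K : 'M[R]_(m, n), forall t : R, 0 <= t ->
        opnorm (expmx (t *: (A + B *m K))) <=
          M * lambda ^+ ((n - 1) * (n + 2) %/ 2)%N * expR (- lambda * t).
Proof.
have [Q Qu QAB] : exists2 Q : 'M[R]_n, Q \in unitmx &
    forall (mu : R) (y : 'rV_n), y = (\row_(j < n) mu ^+ j) *m Q ->
      (y *m A^T - mu *: y <= B^T)%MS.
  by apply: exists_eigenvector_basis => S; exact: controllable_row_full.
pose V0 := Vandermonde n (\row_(i < n) - (i.+1)%:R : 'rV[R]_n).
have V0u : V0 \in unitmx.
  apply: Vandermonde_unitmx => i j; rewrite !mxE => /oppr_inj/eqP.
  by rewrite eqr_nat eqSS => /eqP/val_inj.
pose N : R := n%:R.
pose C1 := N * `|Q^T| * (N * `|V0|).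
pose C2 := N * `|invmx V0| * (N * `|invmx Q^T|).
have C10 : 0 <= C1 by rewrite !mulr_ge0.
have C20 : 0 <= C2 by rewrite !mulr_ge0.
pose C := (n * n)%:R * (N * (N * C1) * C2).
have C0 : 0 <= C by rewrite !mulr_ge0.
exists (1 + C); first by rewrite ltr_pwDl.
move=> lambda lambda1.
have lambda0 : 0 < lambda := lt_le_trans ltr01 lambda1.
pose mu (i : 'I_n) : R := - (i.+1)%:R * lambda.
pose Lam := diag_mx (\row_(j < n) lambda ^+ j).
pose Lam' := diag_mx (\row_(j < n) lambda ^- j).
have LamK : Lam *m Lam' = 1%:M.
  rewrite mulmx_diag; apply/matrixP => i j; rewrite !mxE mulfV//.
  by rewrite expf_neq0// gt_eqF.
(* [Lam *m V0] is the Vandermonde matrix of the [mu i], so column [i] of [W] is the transposed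
   vector [y] of [QAB] for [mu i]. *)
pose W := Q^T *m (Lam *m V0).
pose W' := invmx V0 *m (Lam' *m invmx Q^T).
have WK : W *m W' = 1%:M.
  rewrite /W /W' !mulmxA mulmxK// -(mulmxA Q^T) LamK mulmx1.
  by rewrite mulmxV// unitmx_tr.
pose D := diag_mx (\row_i mu i).
have /submxP[Z ZE] : (W^T *m A^T - D *m W^T <= B^T)%MS.
  apply/row_subP => i.
  rewrite linearB /= !row_mul row_diag_mx -scalemxAl -rowE mxE.
  apply: QAB; rewrite /W trmx_mul trmxK row_mul; congr (_ *m _).
  by apply/rowP => j; rewrite /Lam mul_diag_mx !mxE exprMn mulrC.
(* Transposing [ZE] gives [A *m W - W *m D = B *m Z^T]; this feedback cancels the right side, as
   [W'] inverts [W]. *)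
exists (- Z^T *m W') => t t0.
set K := _ *m W'.
have AKW : (t *: (A + B *m K)) *m W = W *m diag_mx (\row_i (t * mu i)).
  have -> : diag_mx (\row_i (t * mu i)) = t *: D.
    by apply/matrixP => i j; rewrite !mxE mulrnAr.
  rewrite -scalemxAl -scalemxAr; congr (_ *: _).
  rewrite mulmxDl /K -(mulmxA B) -(mulmxA _ W' W) (mulmx1C WK) mulmx1 mulmxN.
  have := congr1 trmx ZE; rewrite linearB /= !trmx_mul !trmxK tr_diag_mx => <-.
  by rewrite subKr.
rewrite (expmx_diagonalized WK AKW).
set E := diag_mx _.
have EE : `|E| <= expR (- lambda * t).
  apply: mx_norm_diag_mx => [|i]; first exact: expR_ge0.
  rewrite !mxE ger0_norm ?expR_ge0// ler_expR /mu.
  rewrite mulrC ler_wpM2r// mulNr lerN2 ler_peMl ?(ltW lambda0)//.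
  by rewrite (ler_nat _ 1).
(* As [lambda >= 1], the entries of [Lam] are at most [lambda ^+ n.-1] and those of [Lam'] at most
   1, so only [W] contributes a power of [lambda]. *)
have WC : `|W| <= C1 * lambda ^+ n.-1.
  rewrite (le_trans (mx_norm_mulmx _ _))// /C1 -[leRHS]mulrA ler_wpM2l//.
  rewrite (le_trans (mx_norm_mulmx _ _))// mulrAC ler_wpM2l//.
  apply: mx_norm_diag_mx => [|i]; first by rewrite exprn_ge0// ltW.
  rewrite mxE ger0_norm ?exprn_ge0 ?(ltW lambda0)// ler_weXn2l// -ltnS prednK//.
have W'C : `|W'| <= C2.
  rewrite (le_trans (mx_norm_mulmx _ _))// /C2 ler_wpM2l ?mulr_ge0//.
  rewrite (le_trans (mx_norm_mulmx _ _))// ler_wpM2r// ler_piMr//.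
  apply: mx_norm_diag_mx => // i.
  rewrite mxE ger0_norm ?invr_ge0 ?exprn_ge0 ?(ltW lambda0)//.
  by rewrite invf_le1 ?exprn_gt0// exprn_ege1.
have WEW' : `|W *m E *m W'| <=
    N * (N * (C1 * lambda ^+ n.-1) * expR (- lambda * t)) * C2.
  rewrite (le_trans (mx_norm_mulmx _ _))// ler_pM ?mulr_ge0// ler_wpM2l//.
  rewrite (le_trans (mx_norm_mulmx _ _))// ler_pM ?mulr_ge0//.
  by rewrite ler_wpM2l.
rewrite (le_trans (opnorm_le_mx_norm _))//.
rewrite (le_trans (ler_wpM2l _ WEW'))//.
have -> : (n * n)%:R * (N * (N * (C1 * lambda ^+ n.-1) * expR (- lambda * t))
    * C2) = C * lambda ^+ n.-1 * expR (- lambda * t) by rewrite /C; ring.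
rewrite ler_wpM2r ?expR_ge0// ler_pM ?exprn_ge0 ?(ltW lambda0) ?lerDr//.
(* The exponent comparison [n - 1 <= L] reduces to [2 <= n + 2]. *)
rewrite ler_weXn2l// leq_divRL// -subn1 leq_mul2l; apply/orP; right.
by rewrite addn2.
Qed.
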